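(* Let $T\in\mathbb N$ be a time horizon and let $\pi$ be a linear bandit policy such that $n^q_T\le B$ almost surely for some fixed $0<B\le T$. Then there exists a $d$-dimensional linear bandit instance with arm set $[-1,1]^d$ for which the expected regret of $\pi$ satisfies $$\mathbb E[\mathrm{Reg}(T)]\ge\frac{dT}{80\sqrt B}.$$
   Context: Linear bandit model with reward queries. An instance with (fixed) arm set $\mathcal X=[-1,1]^d$ is given by an unknown parameter $\theta\in\mathbb R^d$ and a zero-mean subgaussian noise distribution. At each round $t$ the policy selects $x_t\in\mathcal X$ and $q_t\in\{0,1\}$, based on past observations and possibly internal randomization; the reward is $R_t=\langle x_t,\theta\rangle+\eta_t$ with $\eta_t$ drawn independently from the noise distribution, and $R_t$ is observed only if $q_t=1$. $n^q_T=\sum_{t=1}^T\mathbf 1\{q_t=1\}$ is the number of reward queries, and $\mathrm{Reg}(T)=\sum_{t=1}^T\big(\max_{x\in\mathcal X}\langle x,\theta\rangle-\langle x_t,\theta\rangle\big)$. *)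

(* Defs.v *)
From HB Require Import structures.
From mathcomp Require Import all_boot all_order all_algebra.
From mathcomp Require Import all_classical all_reals all_analysis.

Set Implicit Arguments.
Unset Strict Implicit.
Unset Printing Implicit Defensive.

Import Order.TTheory GRing.Theory Num.Theory.

Local Open Scope classical_set_scope.
Local Open Scope ring_scope.

Section iid.
Context {d : measure_display} {S : measurableType d} {R : realType}.

Definition tuple_cons n (p : S * n.-tuple S) : n.+1.-tuple S :=
  [the n.+1.-tuple S of p.1 :: p.2].

Lemma measurable_tuple_cons n : measurable_fun setT (@tuple_cons n).
Proof. exact: measurable_cons measurable_fst measurable_snd. Qed.

HB.instance Definition _ n :=
  isMeasurableFun.Build _ _ _ _ (@tuple_cons n) (@measurable_tuple_cons n).

(* The n-fold product of [nu]: the law of n independent draws from [nu]. *)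
Fixpoint iid_law (nu : probability S R) (n : nat) : probability (n.-tuple S) R :=
  match n with
  | 0 => \d_([tuple] : 0.-tuple S)
  | m.+1 => distribution (nu \x iid_law nu m)%E (@tuple_cons m)
  end.

End iid.

Section bandit.
Context {R : realType} {d : nat}.

(* Vectors of R^d are d-tuples, which carry the product sigma-algebra. *)
Definition dot (x y : d.-tuple R) : R := \sum_(i < d) tnth x i * tnth y i.

Definition arms : set (d.-tuple R) :=
  [set x | forall i, -1 <= tnth x i <= 1].

(* Subgaussian is read with variance proxy 1, E[exp (l eta)] <= exp (l^2 / 2):
   a regret bound with an absolute constant presupposes a noise scale, and with
   a free proxy it could be met just by inflating the noise. *)
Definition subgaussian (nu : probability R R) : Prop :=
  forall l : R, ('M_nu idfun l <= (expR (l ^+ 2 / 2))%:E)%E.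

Record instance := Instance {
  theta : d.-tuple R;
  noise : probability R R;
  noise_zero_mean : ('E_noise[idfun] = 0)%E;
  noise_subgaussian : subgaussian noise }.

(* What the policy learns in one round: the arm, the query bit, and the reward
   if it was queried, replaced by 0 otherwise.  As the query bit is recorded,
   this 0 cannot be confused with an observed reward. *)
Local Notation observation := ((d.-tuple R * bool) * R)%type.

Definition observe (I : instance) (a : d.-tuple R * bool) (eta : R) :
    observation :=
  (a, if a.2 then dot a.1 (theta I) + eta else 0).

(* In round t (counted from 0), [select] maps the private random seed and the
   t past observations to an arm and a query bit.  The seed is drawn once, from
   an arbitrary probability space; a measurable seed-dependent rule covers fresh
   randomization in every round. *)
Record policy := Policy {
  seed_display : measure_display;
  seed : measurableType seed_display;
  seed_law : probability seed R;
  select : forall t : nat,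
    seed * t.-tuple observation -> d.-tuple R * bool;
  measurable_select : forall t, measurable_fun setT (@select t);
  select_arm : forall t w, arms (@select t w).1 }.

Arguments select : clear implicits.

Section interaction.
Variables (pi : policy) (I : instance) (T : nat).

(* An outcome is a seed together with the noise variables of the T rounds. *)
Definition outcome_law : probability (seed pi * T.-tuple R)%type R :=
  (seed_law pi \x iid_law (noise I) T)%E.

Fixpoint history (w : seed pi * T.-tuple R) (t : nat) :
    t.-tuple observation :=
  match t with
  | 0 => [tuple]
  | s.+1 =>
      let h := history w s in
      [tuple of rcons h (observe I (select pi s (w.1, h)) (nth 0 w.2 s))]
  end.

Definition decision (w : seed pi * T.-tuple R) (t : nat) : d.-tuple R * bool :=
  select pi t (w.1, history w t).

Definition num_queries (w : seed pi * T.-tuple R) : nat :=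
  \sum_(t < T) (decision w t).2.

Definition regret (w : seed pi * T.-tuple R) : R :=
  \sum_(t < T) (sup [set dot x (theta I) | x in arms]
                - dot (decision w t).1 (theta I)).

End interaction.
End bandit.

Arguments instance : clear implicits.
Arguments policy : clear implicits.
Arguments num_queries {R d} pi I T w.
Arguments regret {R d} pi I T w.
Arguments select {R d} p t _.
Arguments history {R d} pi I {T} w t.
Arguments decision {R d} pi I {T} w t.

(* Main.v *)
(* The noise is standard normal and the parameter ranges over the sign vectors
   {-D, D}^d with D = 1 / (40 sqrt B).  Flip one coordinate of the parameter.
   Translating the noise of every queried round by the (predictable) difference
   of the two mean rewards leaves everything the policy observes unchanged, so
   by Girsanov's formula the two laws differ by a likelihood ratio L with
   E[L^2] <= exp (4 D^2 B) <= 2, since at most B rounds contribute.  As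
   L - L^2 / 4 <= min 1 L, the regrets caused by this coordinate under the two
   parameters add up to at least T D.  Averaging over all sign vectors, some
   instance has regret at least d T D / 2. *)
From HB Require Import structures.
Require Import Defs.
From mathcomp Require Import all_boot all_order all_algebra.
From mathcomp Require Import all_classical all_reals all_analysis.
From mathcomp Require Import measurable_realfun ring lra.

Import Order.TTheory GRing.Theory Num.Theory.

Local Open Scope classical_set_scope.
Local Open Scope ring_scope.

(** * Translation invariance of Lebesgue integrals *)

Lemma ge0_integral_translation {R : realType} (c : R) (f : R -> \bar R) :
  measurable_fun [set: R] f -> (forall x, 0 <= f x)%E ->
  (\int[lebesgue_measure]_x f (x + c)%R = \int[lebesgue_measure]_x f x)%E.
Proof.
move=> mf f0.
pose phi : R -> measurableTypeR R := fun x => x + c.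
have mphi : measurable_fun setT phi by exact: measurable_funD.
transitivity (\int[pushforward lebesgue_measure phi]_x f x)%E.
  by rewrite ge0_integral_pushforward.
apply: eq_measure_integral => //= A mA _.
(* The pushforward under a translation gives each interval []a, b]] its length, which characterises
   Lebesgue measure. *)
apply/esym/(@lebesgue_measure_unique R) => //= _ [[a b]] _ <-.
rewrite /pushforward (_ : phi @^-1` _ = `]a - c, b - c]%classic).
  rewrite !lebesgue_measure_itv/= !lte_fin ltrD2r -!EFinB.
  by case: ifP => // _; congr EFin; ring.
by apply/seteqP; split => x/=; rewrite !in_itv/= /phi ltrBlDr lerBrDr.
Qed.

(* [normal_prob] lives on the display of [measurableTypeR R], whereas reward
   noise lives on [R] itself: the law is transported along the identity. *)
Definition measurableTypeR_val {R : realType} : measurableTypeR R -> R := idfun.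

Lemma measurable_measurableTypeR_val {R : realType} :
  measurable_fun setT (@measurableTypeR_val R).
Proof. exact: measurable_id. Qed.

HB.instance Definition _ (R : realType) :=
  isMeasurableFun.Build _ _ _ _ (@measurableTypeR_val R)
    measurable_measurableTypeR_val.

Definition std_normal {R : realType} : probability R R :=
  distribution (@normal_prob R 0 1) measurableTypeR_val.

(** * The standard normal law: density, shifts, moments *)

Section standard_normal.
Context {R : realType}.
Local Notation gauss := (@std_normal R).
Local Notation pdf := (@normal_pdf R 0 1).

(** The Radon-Nikodym derivative of [normal_prob] and the explicit density have the same integral
    over every measurable set, so they agree almost everywhere. *)
Lemma ge0_integral_std_normal (f : R -> \bar R) :
  measurable_fun [set: R] f -> (forall x, 0 <= f x)%E ->
  (\int[gauss]_x f x = \int[lebesgue_measure]_x (f x * (pdf x)%:E))%E.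
Proof.
move=> mf f0; have dom := @normal_prob_dominates R 0 1.
have mpdf : measurable_fun [set: R] (EFin \o pdf).
  by apply/measurable_EFinP; exact: measurable_normal_pdf.
have mg := measurable_int _ (Radon_Nikodym_SigmaFinite.f_integrable dom).
rewrite ge0_integral_distribution//.
rewrite -(Radon_Nikodym_SigmaFinite.change_of_variables dom)//.
apply: ae_eq_integral => //.
- exact: emeasurable_funM.
- exact: emeasurable_funM.
apply: ae_eqe_mul2l; apply: integral_ae_eq => //.
- exact: Radon_Nikodym_SigmaFinite.f_integrable.
- by move=> E _ mE; rewrite -Radon_Nikodym_SigmaFinite.f_integral.
Qed.

Lemma normal_pdf01E (x : R) : pdf x = normal_peak 1 * expR (- x ^+ 2 / 2).
Proof. by rewrite normal_pdfE ?oner_eq0// /normal_fun subr0 expr1n. Qed.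

Lemma normal_pdf01_shift (u x : R) :
  pdf (x + u) = expR (- (u * x) - u ^+ 2 / 2) * pdf x.
Proof.
rewrite !normal_pdf01E mulrCA -expRD; congr (_ * expR _).
by field.
Qed.

(** One-dimensional Girsanov formula: the exponential is the density ratio [pdf (x + u) / pdf x],
    and Lebesgue measure is translation invariant. *)
Lemma ge0_integral_normal_shift (u : R) (f : R -> \bar R) :
  measurable_fun [set: R] f -> (forall x, 0 <= f x)%E ->
  (\int[gauss]_x (f (x + u)%R * (expR (- (u * x) - u ^+ 2 / 2))%:E) =
   \int[gauss]_x f x)%E.
Proof.
move=> mf f0.
have mfu : measurable_fun setT (fun x : R => f (x + u)).
  by apply: measurableT_comp => //; exact: measurable_funD.
have me : measurable_fun setT (fun x : R => (expR (- (u * x) - u ^+ 2 / 2))%:E).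
  apply/measurable_EFinP; apply: measurableT_comp => //.
  apply: measurable_funB => //; apply: measurable_funN.
  exact: measurable_funM.
rewrite !ge0_integral_std_normal//; last 2 first.
- exact: emeasurable_funM.
- by move=> x; rewrite mule_ge0// lee_fin expR_ge0.
rewrite -(ge0_integral_translation u (fun x => f x * (pdf x)%:E)%E).
- by apply: eq_integral => x _; rewrite normal_pdf01_shift EFinM muleA.
- apply: emeasurable_funM => //; apply/measurable_EFinP.
  exact: measurable_normal_pdf.
- by move=> x; rewrite mule_ge0// lee_fin normal_pdf_ge0.
Qed.

Lemma integral_normal_expR (l : R) :
  (\int[gauss]_x (expR (l * x))%:E = (expR (l ^+ 2 / 2))%:E)%E.
Proof.
(* Shifting by [- l] gives the weight [exp (l x - l^2 / 2)]; the constant function removes the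
   second term. *)
have := ge0_integral_normal_shift (- l) (cst (expR (l ^+ 2 / 2))%:E).
rewrite integral_cst//= probability_setT mule1 => <-//.
apply: eq_integral => x _; rewrite -EFinM -expRD; congr (expR _)%:E.
by field.
Qed.

Lemma ge0_integral_normalN (f : R -> \bar R) :
  measurable_fun [set: R] f -> (forall x, 0 <= f x)%E ->
  (\int[gauss]_x f (- x)%R = \int[gauss]_x f x)%E.
Proof.
move=> mf f0; rewrite !ge0_integral_std_normal//; last first.
  exact: measurableT_comp.
have mpdf : measurable_fun setT (fun x => f x * (pdf x)%:E)%E.
  apply: emeasurable_funM => //; apply/measurable_EFinP.
  exact: measurable_normal_pdf.
pose phi : measurableTypeR R -> measurableTypeR R := -%R.
have mphi : measurable_fun setT phi by exact: oppr_measurable.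
transitivity (\int[pushforward lebesgue_measure phi]_x (f x * (pdf x)%:E))%E.
  rewrite (ge0_integral_pushforward mphi _ measurableT mpdf).
    by apply: eq_integral => x _; rewrite /phi/= !normal_pdf01E sqrrN.
  by move=> x _; rewrite mule_ge0// lee_fin normal_pdf_ge0.
by apply: eq_measure_integral => //= A mA _; exact: lebesgue_measureN.
Qed.

Lemma expectation_normal : ('E_gauss[idfun] = 0)%E.
Proof.
rewrite unlock; pose g (x : R) := x%:E; change (\int[gauss]_x g x = 0)%E.
have mg : measurable_fun [set: R] g by exact: EFin_measurable.
have mgp : measurable_fun [set: R] (g^\+)%E by exact: measurable_funepos.
(* By symmetry the positive and negative parts have the same integral. It remains to see that this
   integral is finite, so that the difference is 0. *)
rewrite integralE.
have -> : (\int[gauss]_x g^\- x = \int[gauss]_x g^\+ x)%E.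
  rewrite -(ge0_integral_normalN (g^\+)%E)//.
  by apply: eq_integral => x _; rewrite funenegE funeposE.
rewrite subee// ge0_fin_numE ?integral_ge0//.
apply: (@le_lt_trans _ _ (\int[gauss]_x (expR (1 * x))%:E)%E); last first.
  by rewrite integral_normal_expR ltry.
apply: ge0_le_integral => //.
- by apply/measurable_EFinP; apply: measurableT_comp.
- move=> x _; rewrite funeposE -EFin_max lee_fin ge_max expR_ge0 mul1r andbT.
  by rewrite (le_trans _ (expR_ge1Dx _))// lerDr.
Qed.

Lemma subgaussian_normal : subgaussian gauss.
Proof.
move=> l; rewrite /mmt_gen_fun unlock -integral_normal_expR.
by under eq_integral do rewrite /= mulrC.
Qed.

End standard_normal.

(** * Girsanov's formula for predictable shifts of independent normal noise *)

Lemma ge0_integral_iid_lawS {dS} {S : measurableType dS} {R : realType}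
    (nu : probability S R) n (f : n.+1.-tuple S -> \bar R) :
  measurable_fun setT f -> (forall e, 0 <= f e)%E ->
  (\int[iid_law nu n.+1]_e f e =
   \int[nu]_x \int[iid_law nu n]_e f [the n.+1.-tuple S of x :: e])%E.
Proof.
move=> mf f0; rewrite /= ge0_integral_distribution//.
rewrite fubini_tonelli1//=.
by apply: measurableT_comp => //; exact: measurable_tuple_cons.
Qed.

Section girsanov.
Context {R : realType} {dS : measure_display} {S : measurableType dS}.
Implicit Type u : forall t, S * t.-tuple R -> R.

(** Total in [t]: positions from [n] on get the default 0, which never occurs for [t <= n]. *)
Definition noise_prefix t {n} (e : n.-tuple R) : t.-tuple R :=
  [tuple nth 0 e i | i < t].

(** Predictable by construction: the shift of round [i] sees the seed and the noise of the rounds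
    before [i]. *)
Definition drift u {n} (w : S * n.-tuple R) (i : nat) : R :=
  u i (w.1, noise_prefix i w.2).

Definition translate u {n} (w : S * n.-tuple R) : n.-tuple R :=
  [tuple tnth w.2 i + drift u w i | i < n].

(** The exponential martingale of Girsanov's formula. *)
Definition likelihood u {n} (w : S * n.-tuple R) : R :=
  expR (\sum_(i < n) (- (drift u w i * tnth w.2 i) - drift u w i ^+ 2 / 2)).

Lemma measurable_nth n i :
  measurable_fun setT (fun e : n.-tuple R => nth 0 e i).
Proof.
have [lin|len] := ltnP i n.
  rewrite (_ : (fun _ => _) = (fun e => tnth e (Ordinal lin))).
    exact: measurable_tnth.
  by apply/funext => e; rewrite (tnth_nth 0).
rewrite (_ : (fun _ => _) = cst 0) //.
by apply/funext => e; rewrite nth_default// size_tuple.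
Qed.

Lemma measurable_noise_prefix t n : measurable_fun setT (@noise_prefix t n).
Proof.
apply/measurable_fun_tnthP => i.
apply: (eq_measurable_fun (fun e : n.-tuple R => nth 0 e i)).
  by move=> e _; rewrite /= tnth_mktuple.
exact: measurable_nth.
Qed.

Lemma nth_noise_prefix t n (e : n.-tuple R) i : (i < t)%N ->
  nth 0 (noise_prefix t e) i = nth 0 e i.
Proof.
move=> it; rewrite -[LHS](tnth_nth 0 (noise_prefix t e) (Ordinal it)).
by rewrite tnth_mktuple.
Qed.

Lemma nth_translate u n (w : S * n.-tuple R) i : (i < n)%N ->
  nth 0 (translate u w) i = nth 0 w.2 i + drift u w i.
Proof.
move=> lt_in; rewrite -[LHS](tnth_nth 0 (translate u w) (Ordinal lt_in)).
by rewrite tnth_mktuple (tnth_nth 0).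
Qed.

Section measurability.
Variable u : forall t, S * t.-tuple R -> R.
Hypothesis mu : forall t, measurable_fun setT (u t).

Lemma measurable_drift n i :
  measurable_fun setT (fun w : S * n.-tuple R => drift u w i).
Proof.
apply: (measurableT_comp (mu i)); apply: measurable_fun_pair => //.
by apply: (measurableT_comp (measurable_noise_prefix i n)).
Qed.

Lemma measurable_translate n : measurable_fun setT (@translate u n).
Proof.
apply/measurable_fun_tnthP => i.
apply: (eq_measurable_fun (fun w : S * n.-tuple R => tnth w.2 i + drift u w i)).
  by move=> e _; rewrite /= tnth_mktuple.
apply: measurable_funD; last exact: measurable_drift.
by apply: (measurableT_comp (measurable_tnth i)).
Qed.

Lemma measurable_likelihood n : measurable_fun setT (@likelihood u n).
Proof.
apply: measurableT_comp => //; apply: measurable_sum => i.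
apply: measurable_funB; last first.
  apply: measurable_funM => //; apply: measurable_funX; exact: measurable_drift.
apply: measurable_funN; apply: measurable_funM; first exact: measurable_drift.
by apply: (measurableT_comp (measurable_tnth i)).
Qed.

End measurability.

Lemma noise_prefixS t n x (e : n.-tuple R) :
  noise_prefix t.+1 [the n.+1.-tuple R of x :: e] =
  [the t.+1.-tuple R of x :: noise_prefix t e].
Proof.
apply: eq_from_tnth => i; rewrite tnth_mktuple.
case: (unliftP ord0 i) => [j|] ->; last by rewrite tnth0.
by rewrite tnthS tnth_mktuple.
Qed.

Definition after u x t (w : S * t.-tuple R) : R :=
  u t.+1 (w.1, [the t.+1.-tuple R of x :: w.2]).

Lemma driftS u n s x (e : n.-tuple R) i :
  drift u (s, [the n.+1.-tuple R of x :: e]) i.+1 = drift (after u x) (s, e) i.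
Proof. by rewrite /drift /after /= noise_prefixS. Qed.

Lemma translateS u n s x (e : n.-tuple R) :
  translate u (s, [the n.+1.-tuple R of x :: e]) =
  [the n.+1.-tuple R of x + u 0 (s, [tuple]) :: translate (after u x) (s, e)].
Proof.
apply: eq_from_tnth => i; rewrite tnth_mktuple.
case: (unliftP ord0 i) => [j|] ->.
  by rewrite !tnthS tnth_mktuple lift0 driftS.
by rewrite !tnth0 /drift tuple0.
Qed.

Lemma likelihoodS u n s x (e : n.-tuple R) :
  likelihood u (s, [the n.+1.-tuple R of x :: e]) =
  expR (- (u 0 (s, [tuple]) * x) - u 0 (s, [tuple]) ^+ 2 / 2) *
  likelihood (after u x) (s, e).
Proof.
rewrite /likelihood big_ord_recl expRD tnth0 {1 2}/drift tuple0.
congr (_ * expR _); apply: eq_bigr => i _.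
by rewrite tnthS lift0 driftS.
Qed.

Lemma likelihood_ge0 u n (w : S * n.-tuple R) : 0 <= likelihood u w.
Proof. exact: expR_ge0. Qed.

Lemma measurable_after u x t :
  measurable_fun setT (u t.+1) -> measurable_fun setT (after u x t).
Proof.
move=> mu; apply: (measurableT_comp mu); apply: measurable_fun_pair => //.
exact: measurable_cons.
Qed.

(* Induction on the horizon: conditioning on the first noise variable leaves
   the same situation with the family [after u x]. *)
Lemma ge0_integral_girsanov_pointwise n u s (f : n.-tuple R -> \bar R) :
    (forall t, measurable_fun setT (u t)) ->
    measurable_fun setT f -> (forall e, 0 <= f e)%E ->
  (\int[iid_law std_normal n]_e
      (f (translate u (s, e)) * (likelihood u (s, e))%:E) =
   \int[iid_law std_normal n]_e f e)%E.
Proof.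
elim: n u f => [|n IH] u f mu mf f0.
  apply: eq_integral => e _; rewrite /likelihood big_ord0 expR0 mule1.
  by congr f; rewrite [LHS]tuple0 [RHS]tuple0.
have mfx (x : R) :
    measurable_fun setT (fun e : n.-tuple R => f [the n.+1.-tuple R of x :: e]).
  by apply: measurableT_comp => //; exact: measurable_cons.
rewrite !ge0_integral_iid_lawS//; last 2 first.
- apply: emeasurable_funM.
    apply: measurableT_comp => //.
    apply: (measurableT_comp (measurable_translate _ mu _)).
    exact: measurable_fun_pair.
  apply/measurable_EFinP.
  apply: (measurableT_comp (measurable_likelihood _ mu _)).
  exact: measurable_fun_pair.
- by move=> e; rewrite mule_ge0// lee_fin likelihood_ge0.
pose G (x : R) :=
  (\int[iid_law std_normal n]_e f [the n.+1.-tuple R of x :: e])%E.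
have mG : measurable_fun setT G.
  apply: (measurable_fun_fubini_tonelli_F (fun p => f (tuple_cons p))) => //.
  by apply: measurableT_comp => //; exact: measurable_tuple_cons.
have G0 x : (0 <= G x)%E by apply: integral_ge0.
(* With the seed fixed, the first shift is a constant, so the one-dimensional formula treats the
   first draw; [IH] then treats the others. *)
rewrite -(ge0_integral_normal_shift (u 0 (s, [tuple])) G)//.
apply: eq_integral => x _.
have ma t : measurable_fun setT (after u x t) by exact: measurable_after.
rewrite /G -(IH (after u x) (fun e => f [the n.+1.-tuple R of x + _ :: e]))//.
rewrite -ge0_integralZr//.
- apply: eq_integral => e _.
  by rewrite translateS likelihoodS EFinM muleAC -muleA.
- apply: emeasurable_funM.
    apply: (measurableT_comp (mfx _)).
    apply: (measurableT_comp (measurable_translate (after u x) ma _)).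
    exact: measurable_fun_pair.
  apply/measurable_EFinP.
  apply: (measurableT_comp (measurable_likelihood (after u x) ma _)).
  exact: measurable_fun_pair.
- by move=> e _; rewrite mule_ge0// lee_fin likelihood_ge0.
Qed.

Lemma ge0_integral_girsanov n u (P : probability S R)
    (f : S * n.-tuple R -> \bar R) :
    (forall t, measurable_fun setT (u t)) ->
    measurable_fun setT f -> (forall w, 0 <= f w)%E ->
  (\int[P \x iid_law std_normal n]_w
      (f (w.1, translate u w) * (likelihood u w)%:E) =
   \int[P \x iid_law std_normal n]_w f w)%E.
Proof.
move=> mu mf f0; rewrite !fubini_tonelli1//; last 2 first.
- apply: emeasurable_funM.
    apply: measurableT_comp => //; apply: measurable_fun_pair => //.
    exact: measurable_translate.
  apply/measurable_EFinP; exact: measurable_likelihood.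
- by move=> w; rewrite mule_ge0// lee_fin likelihood_ge0.
apply: eq_integral => s _; rewrite /fubini_F/=.
apply: (@ge0_integral_girsanov_pointwise n u s (fun e => f (s, e))) => //.
exact: measurableT_comp.
Qed.

End girsanov.

Lemma integral_likelihood {R : realType} {dS} {S : measurableType dS}
    (u : forall t, S * t.-tuple R -> R) (P : probability S R) n :
    (forall t, measurable_fun setT (u t)) ->
  (\int[P \x iid_law std_normal n]_w (likelihood u w)%:E = 1)%E.
Proof.
move=> mu; rewrite -[RHS](probability_setT (P \x iid_law std_normal n)%E).
rewrite -[RHS]mul1e -integral_cst//.
rewrite -(ge0_integral_girsanov n u P (cst 1%E))//.
by apply: eq_integral => w _; rewrite mul1e.
Qed.

(** * Second moment of the likelihood ratio and the two-point bound *)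

Section two_points_bound.
Context {R : realType} {dS : measure_display} {S : measurableType dS}.
Variables (u : forall t, S * t.-tuple R -> R) (P : probability S R) (n : nat).
Hypothesis mu : forall t, measurable_fun setT (u t).
Local Notation law := (P \x iid_law std_normal n)%E.

Let dbl t w : R := 2 * u t w.

Let mdbl t : measurable_fun setT (dbl t).
Proof. by apply: measurable_funM => //; exact: mu. Qed.

(** Completing the square in each round: [- 2 u x - u^2 = u^2 - (2 u) x - (2 u)^2 / 2]. *)
Lemma likelihood_sqr (w : S * n.-tuple R) :
  likelihood u w ^+ 2 = expR (\sum_(i < n) drift u w i ^+ 2) * likelihood dbl w.
Proof.
rewrite expr2 /likelihood -!expRD -!big_split/=; congr expR.
apply: eq_bigr => i _.
by rewrite (_ : drift dbl w i = 2 * drift u w i)//; field.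
Qed.

(** The likelihood of the doubled drift has integral 1, so the bound on the sum of squared drifts is
    all that remains. *)
Lemma integral_likelihood_sqr (v : R) :
  {ae law, forall w, \sum_(i < n) drift u w i ^+ 2 <= v} ->
  (\int[law]_w (likelihood u w ^+ 2)%:E <= (expR v)%:E)%E.
Proof.
move=> uv.
have ml := measurable_likelihood dbl mdbl n.
rewrite -[leRHS]mule1 -(integral_likelihood dbl P n mdbl).
rewrite -ge0_integralZl//; last 2 first.
- exact/measurable_EFinP.
- by move=> w _; rewrite lee_fin likelihood_ge0.
apply: ae_ge0_le_integral => //.
- by move=> w _; rewrite lee_fin sqr_ge0.
- apply/measurable_EFinP; apply: measurable_funX; exact: measurable_likelihood.
- by move=> w _; rewrite -EFinM lee_fin mulr_ge0 ?expR_ge0 ?likelihood_ge0.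
- by apply/measurable_EFinP; apply: measurable_funM.
apply: filterS uv => w uvw _.
by rewrite -EFinM lee_fin likelihood_sqr ler_wpM2r ?likelihood_ge0 ?ler_expR.
Qed.

(* Le Cam's two-point bound in chi-square form: [L - L^2 / 4 <= min 1 L], so the
   overlap of the two laws is at least [1 - E[L^2] / 4]. *)
Lemma two_point_bound (f g : S * n.-tuple R -> R) (M v : R) :
    measurable_fun setT f -> measurable_fun setT g ->
    0 <= M -> (forall w, 0 <= f w <= M) -> (forall w, 0 <= g w) ->
    (forall w, g (w.1, translate u w) = M - f w) ->
    {ae law, forall w, \sum_(i < n) drift u w i ^+ 2 <= v} ->
    expR v <= 2 ->
  ((M / 2)%:E <= \int[law]_w (f w)%:E + \int[law]_w (g w)%:E)%E.
Proof.
move=> mf mg M0 fM g0 gf uv v2.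
have ml := measurable_likelihood u mu n.
have mfM :
    measurable_fun setT (fun w : S * n.-tuple R => (M - f w) * likelihood u w).
  by apply: measurable_funM => //; exact: measurable_funB.
have ml2 :
    measurable_fun setT
      (fun w : S * n.-tuple R => (M / 4) * likelihood u w ^+ 2).
  by apply: measurable_funM => //; exact: measurable_funX.
have l0 := @likelihood_ge0 _ _ _ u n.
have fM0 w : 0 <= (M - f w) * likelihood u w.
  by rewrite mulr_ge0// subr_ge0; case/andP: (fM w).
have L2 : (\int[law]_w ((M / 4) * likelihood u w ^+ 2)%:E <= (M / 2)%:E)%E.
  under eq_integral do rewrite EFinM.
  rewrite ge0_integralZl//; last 3 first.
  - by apply/measurable_EFinP; exact: measurable_funX.
  - by move=> w _; rewrite lee_fin sqr_ge0.
  - by rewrite lee_fin divr_ge0.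
  rewrite (_ : M / 2 = M / 4 * 2); last by field.
  rewrite [leRHS]EFinM lee_wpmul2l ?lee_fin ?divr_ge0//.
  by rewrite (le_trans (integral_likelihood_sqr v uv))// lee_fin.
(* Girsanov's formula expresses the integral of [g] through the translated run, where [g] equals
   [M - f]. *)
have gE : (\int[law]_w (g w)%:E =
           \int[law]_w ((M - f w) * likelihood u w)%:E)%E.
  rewrite -(ge0_integral_girsanov n u P (EFin \o g))//.
  - by apply: eq_integral => w _ /=; rewrite gf EFinM.
  - exact/measurable_EFinP.
have key : (M%:E <= \int[law]_w (f w)%:E + \int[law]_w (g w)%:E +
    \int[law]_w ((M / 4) * likelihood u w ^+ 2)%:E)%E.
  rewrite gE -!ge0_integralD//; try exact/measurable_EFinP.
  - rewrite -[leLHS]mule1 -(integral_likelihood u P n mu).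
    rewrite -ge0_integralZl//; last 2 first.
    + exact/measurable_EFinP.
    + by move=> w _; rewrite lee_fin.
    apply: ge0_le_integral => //.
    + by move=> w _; rewrite -EFinM lee_fin mulr_ge0.
    + by apply/measurable_EFinP; apply: measurable_funM.
    + apply/measurable_EFinP; apply: measurable_funD => //.
      exact: measurable_funD.
    + move=> w _; rewrite -!EFinD -EFinM lee_fin.
      have /andP[f0 f1] := fM w; have := l0 w.
      set l := likelihood u w => l1.
      (* To show: [0 <= f (1 - l) + M l^2 / 4]. Both terms are nonnegative if [l <= 1]; otherwise
         the sum equals [(M - f) (l - 1) + M (1 - l / 2)^2]. *)
      have [l_le1|l_gt1] := lerP l 1.
        have : 0 <= f w * (1 - l) by rewrite mulr_ge0// subr_ge0.
        have : 0 <= M / 4 * l ^+ 2 by rewrite mulr_ge0 ?divr_ge0 ?sqr_ge0.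
        lra.
      have : 0 <= (M - f w) * (l - 1) by rewrite mulr_ge0 ?subr_ge0// ltW.
      have : 0 <= M * (1 - l / 2) ^+ 2 by rewrite mulr_ge0 ?sqr_ge0.
      lra.
  - by move=> w _; rewrite adde_ge0// lee_fin//; case/andP: (fM w).
  - by apply/measurable_EFinP; exact: measurable_funD.
  - by move=> w _; rewrite lee_fin mulr_ge0 ?divr_ge0 ?sqr_ge0.
  - by move=> w _; rewrite lee_fin; case/andP: (fM w).
  - by move=> w _; rewrite lee_fin.
have {key} := le_trans key (leeD2l _ L2).
rewrite -leeBlDr// -EFinB.
by rewrite (_ : M - M / 2 = M / 2)//; field.
Qed.

End two_points_bound.

(** * Measurability of the interaction *)

Lemma measurable_rcons {d1 d2} {T1 : measurableType d1} {T2 : measurableType d2}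
    n (f : T1 -> n.-tuple T2) (g : T1 -> T2) :
  measurable_fun setT f -> measurable_fun setT g ->
  measurable_fun setT (fun x => [tuple of rcons (f x) (g x)]).
Proof.
move=> mf mg; apply/measurable_fun_tnthP => i.
have [lin|len] := ltnP i n.
  apply: (eq_measurable_fun (fun x => tnth (f x) (Ordinal lin))).
    move=> x _; rewrite /= !(tnth_nth (g x)) /= nth_rcons size_tuple.
    by rewrite lin.
  by apply: (measurableT_comp (measurable_tnth _)).
apply: (eq_measurable_fun g) => // x _.
rewrite /= (tnth_nth (g x)) /= nth_rcons size_tuple ltnNge len/=.
by rewrite eqn_leq len -ltnS ltn_ord.
Qed.

Section measurability.
Context {R : realType} {d : nat}.
Variables (pi : policy R d) (I : instance R d).

Lemma measurable_dot (y : d.-tuple R) : measurable_fun setT (dot^~ y).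
Proof.
apply: measurable_sum => i; apply: measurable_funM => //.
exact: measurable_tnth.
Qed.

Lemma measurable_observe :
  measurable_fun setT (fun p : d.-tuple R * bool * R => observe I p.1 p.2).
Proof.
apply: measurable_fun_pair => //; apply: measurable_fun_ifT => //.
  by apply: (measurableT_comp (measurable_snd : measurable_fun setT _)).
apply: measurable_funD => //; apply: (measurableT_comp (measurable_dot _)).
by apply: (measurableT_comp measurable_fst).
Qed.

Lemma measurable_history n t :
  measurable_fun setT (fun w : seed pi * n.-tuple R => history pi I w t).
Proof.
elim: t => [|t IH]; first exact: measurable_cst.
apply: measurable_rcons => //.
pose obs (w : seed pi * n.-tuple R) :=
  (select pi t (w.1, history pi I w t), nth 0 w.2 t).
apply: (measurableT_comp measurable_observe (g := obs)).
apply: measurable_fun_pair.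
  apply: (measurableT_comp (@measurable_select _ _ pi t)).
  exact: measurable_fun_pair.
by apply: (measurableT_comp (measurable_nth _ _)).
Qed.

Lemma measurable_decision n t :
  measurable_fun setT (fun w : seed pi * n.-tuple R => decision pi I w t).
Proof.
apply: (measurableT_comp (@measurable_select _ _ pi t)).
by apply: measurable_fun_pair => //; exact: measurable_history.
Qed.

End measurability.

(** * Coupling the runs on two instances by translating the noise *)

Section change_of_instance.
Context {R : realType} {d : nat}.
Variables (pi : policy R d) (I J : instance R d).

(** The two noise tuples may differ in length, so that a run on the full noise can be compared with
    one on a prefix of it. *)
Lemma eq_history s n m (e : n.-tuple R) (e' : m.-tuple R) t :
    (forall i, (i < t)%N -> nth 0 e i = nth 0 e' i) ->
  history pi I (s, e) t = history pi I (s, e') t.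
Proof.
elim: t => [//|t IH] ee'; rewrite /= ee'// IH// => i it.
by rewrite ee'// (ltn_trans it).
Qed.

(* The shift of the noise of the current round that compensates, on what the
   policy observes, for replacing [I] by [J]. *)
Definition gap t (w : seed pi * t.-tuple R) : R :=
  let a := decision pi I w t in
  if a.2 then dot a.1 (theta I) - dot a.1 (theta J) else 0.

Lemma measurable_gap t : measurable_fun setT (gap t).
Proof.
have md := measurable_decision pi I t t.
apply: measurable_fun_ifT => //.
  by apply: (measurableT_comp (measurable_snd : measurable_fun setT _) md).
by apply: measurable_funB; apply: (measurableT_comp (measurable_dot _));
  apply: (measurableT_comp measurable_fst md).
Qed.

Lemma drift_gap n (w : seed pi * n.-tuple R) i :
  drift gap w i = let a := decision pi I w i in
    if a.2 then dot a.1 (theta I) - dot a.1 (theta J) else 0.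
Proof.
rewrite /drift /gap /decision; case: w => s e /=.
rewrite (@eq_history s _ _ (noise_prefix i e) e)// => k ki.
by rewrite nth_noise_prefix.
Qed.

(** In a queried round the shift turns the mean reward under [J] into the one under [I]; in any
    other round both runs record 0. *)
Lemma history_translate n (w : seed pi * n.-tuple R) t : (t <= n)%N ->
  history pi J (w.1, translate gap w) t = history pi I w t.
Proof.
elim: t => [//|t IH] tn; rewrite /= IH ?(ltnW tn)//.
congr [tuple of rcons _ _]; rewrite /observe; congr (_, _).
rewrite nth_translate// drift_gap /decision /=; case: ifP => // ->.
by ring.
Qed.

Lemma decision_translate n (w : seed pi * n.-tuple R) (t : 'I_n) :
  decision pi J (w.1, translate gap w) t = decision pi I w t.
Proof. by rewrite /decision history_translate// ltnW. Qed.

End change_of_instance.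

Lemma expR_le_inv1B {R : realType} (x : R) : x < 1 -> expR x <= (1 - x)^-1.
Proof.
move=> x1; rewrite -[expR x]invrK -expRN lef_pV2 ?posrE ?expR_gt0 ?subr_gt0//.
exact: expR_ge1Dx.
Qed.

(** * The hard instances and their regret, coordinate by coordinate *)

Section sign_vectors.
Context {R : realType} {d : nat}.
Implicit Types (s : {ffun 'I_d -> bool}) (D : R).

Definition sign_theta D s : d.-tuple R := [tuple (-1) ^+ s i * D | i < d].

Definition sign_instance D s : instance R d :=
  Instance (sign_theta D s) expectation_normal subgaussian_normal.

Definition flip (i : 'I_d) s : {ffun 'I_d -> bool} :=
  [ffun j => if j == i then ~~ s j else s j].

Lemma flipK i : involutive (flip i).
Proof.
by move=> s; apply/ffunP => j; rewrite !ffunE; case: eqP => // _; rewrite negbK.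
Qed.

Lemma dot_sign_theta D s x :
  dot x (sign_theta D s) = \sum_(i < d) tnth x i * ((-1) ^+ s i * D).
Proof. by apply: eq_bigr => i _; rewrite tnth_mktuple. Qed.

Lemma arm_coord_le D s (x : d.-tuple R) i : 0 <= D -> arms x ->
  `|tnth x i * ((-1) ^+ s i * D)| <= D.
Proof.
move=> D0 /(_ i) /andP[x1 x2]; rewrite !normrM normr_sign mul1r (ger0_norm D0).
by rewrite ler_piMl// ler_norml x1.
Qed.

Lemma sup_dot_sign_theta D s : 0 <= D ->
  sup [set dot x (sign_theta D s) | x in arms] = d%:R * D.
Proof.
(* The optimal arm is the vertex of the cube with the signs of the parameter; each coordinate then
   contributes [D]. *)
move=> D0; pose x : d.-tuple R := [tuple (-1) ^+ s i | i < d].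
have armx : arms x.
  move=> i; rewrite tnth_mktuple; apply/andP.
  by case: (s i) => /=; rewrite ?expr0 ?expr1; split; lra.
have dotx : dot x (sign_theta D s) = d%:R * D.
  rewrite dot_sign_theta -[d in RHS]card_ord mulr_natl -sumr_const.
  apply: eq_bigr => i _; rewrite tnth_mktuple.
  by case: (s i) => /=; rewrite ?expr0 ?expr1; ring.
have ub : ubound [set dot x (sign_theta D s) | x in arms] (d%:R * D).
  move=> _ [y army <-]; rewrite -dotx !dot_sign_theta ler_sum// => i _.
  rewrite [leRHS](_ : _ = D).
    exact: le_trans (ler_norm _) (arm_coord_le D s y i D0 army).
  by rewrite tnth_mktuple; case: (s i) => /=; rewrite ?expr0 ?expr1; ring.
apply/le_anti/andP; split.
- by apply: ge_sup => //; exists (d%:R * D), x.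
- by apply: ub_le_sup; [exists (d%:R * D)|exists x].
Qed.

Lemma dot_flip D s i x :
  dot x (sign_theta D s) - dot x (sign_theta D (flip i s)) =
  2 * (tnth x i * ((-1) ^+ s i * D)).
Proof.
rewrite !dot_sign_theta -sumrB (bigD1 i)//= ffunE eqxx big1 => [|j ji].
  by case: (s i) => /=; rewrite ?expr0 ?expr1; ring.
by rewrite ffunE (negbTE ji) subrr.
Qed.

Section regret.
Variables (pi : policy R d) (n : nat) (D : R).
Hypothesis D0 : 0 <= D.
Local Notation law := (seed_law pi \x iid_law std_normal n)%E.

(** The share of coordinate [i]: on a cube the best arm maximises each coordinate separately, with
    value [D]. *)
Definition coord_regret s i (w : seed pi * n.-tuple R) : R :=
  \sum_(t < n) (D - tnth (decision pi (sign_instance D s) w t).1 i *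
                    ((-1) ^+ s i * D)).

Lemma regret_coord s w :
  regret pi (sign_instance D s) n w = \sum_(i < d) coord_regret s i w.
Proof.
rewrite exchange_big/=; apply: eq_bigr => t _.
rewrite sup_dot_sign_theta// dot_sign_theta sumrB sumr_const card_ord.
by rewrite mulr_natl.
Qed.

Lemma measurable_coord_regret s i : measurable_fun setT (coord_regret s i).
Proof.
apply: measurable_sum => t; apply: measurable_funB => //.
apply: measurable_funM => //; apply: (measurableT_comp (measurable_tnth i)).
exact: (measurableT_comp measurable_fst (measurable_decision _ _ _ _)).
Qed.

Lemma coord_regret_bounds s i w : 0 <= coord_regret s i w <= n%:R * (2 * D).
Proof.
have b t := arm_coord_le D s _ i D0
  (select_arm (w.1, history pi (sign_instance D s) w t)
   : arms (decision _ _ w t).1).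
rewrite sumr_ge0/=; last first.
  by move=> t _; have := b t; rewrite ler_norml; lra.
rewrite -[n in leRHS]card_ord mulr_natl -sumr_const ler_sum// => t _.
by have := b t; rewrite ler_norml; lra.
Qed.

(** The coupled run plays the same arms while the sign at [i] is reversed, so the two losses of a
    round, [D - z] and [D + z], add up to [2 D]. *)
Lemma coord_regret_flip s i w :
  coord_regret (flip i s) i
    (w.1,
     translate (gap pi (sign_instance D s) (sign_instance D (flip i s))) w) =
  n%:R * (2 * D) - coord_regret s i w.
Proof.
rewrite -[n in n%:R]card_ord mulr_natl -sumr_const -sumrB.
apply: eq_bigr => t _; rewrite decision_translate ffunE eqxx.
by case: (s i) => /=; rewrite ?expr0 ?expr1; ring.
Qed.

(** Unqueried rounds have no drift; in a queried one the two means differ by twice the contribution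
    of coordinate [i], hence by at most [2 D]. *)
Lemma sum_sqr_drift_gap s i (w : seed pi * n.-tuple R) :
  \sum_(t < n)
    drift (gap pi (sign_instance D s) (sign_instance D (flip i s))) w t ^+ 2 <=
  4 * D ^+ 2 * (num_queries pi (sign_instance D s) n w)%:R.
Proof.
rewrite natr_sum mulr_sumr ler_sum// => t _; rewrite drift_gap/=.
case: ifP => _; last by rewrite expr0n mulr0.
rewrite dot_flip exprMn mulr1 -natrX ler_wpM2l//.
rewrite -ler_sqrt ?sqr_ge0// !sqrtr_sqr (ger0_norm D0).
exact: (arm_coord_le D s _ i D0 (select_arm _)).
Qed.

(** The two-point bound with [M = 2 n D] and [v = 4 D^2 B]. Both integrals are over the same [law],
    as all sign instances share the normal noise. *)
Lemma coord_regret_flip_sum s i (B : R) :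
    {ae outcome_law pi (sign_instance D s) n,
      forall w, (num_queries pi (sign_instance D s) n w)%:R <= B} ->
    4 * D ^+ 2 * B <= 1 / 2 ->
  ((n%:R * D)%:E <= \int[law]_w (coord_regret s i w)%:E +
                    \int[law]_w (coord_regret (flip i s) i w)%:E)%E.
Proof.
move=> qB DB.
rewrite (_ : n%:R * D = n%:R * (2 * D) / 2); last by field.
apply: (two_point_bound _ _ _ (measurable_gap pi (sign_instance D s)
  (sign_instance D (flip i s))) _ _ _ (4 * D ^+ 2 * B)).
- exact: measurable_coord_regret.
- exact: measurable_coord_regret.
- by rewrite mulr_ge0// mulr_ge0.
- exact: coord_regret_bounds.
- by move=> w; case/andP: (coord_regret_bounds (flip i s) i w).
- exact: coord_regret_flip.
- apply: filterS qB => w qB; apply: le_trans (sum_sqr_drift_gap s i w) _.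
  by rewrite ler_wpM2l// mulr_ge0 ?sqr_ge0.
(* As [v <= 1 / 2], [exp v <= 1 / (1 - v) <= 2]. *)
- apply: le_trans (expR_le_inv1B _ _) _; first lra.
  by rewrite -[leRHS]invrK lef_pV2 ?posrE; lra.
Qed.

Lemma expected_regret_coord s :
  ('E_(outcome_law pi (sign_instance D s) n)[regret pi (sign_instance D s) n] =
   \sum_(i < d) \int[law]_w (coord_regret s i w)%:E)%E.
Proof.
rewrite unlock -ge0_integral_sum//.
- by apply: eq_integral => w _; rewrite regret_coord sumEFin.
- by move=> i; apply/measurable_EFinP; exact: measurable_coord_regret.
- by move=> i w _; rewrite lee_fin; case/andP: (coord_regret_bounds s i w).
Qed.

End regret.
End sign_vectors.

(** * Averaging over the sign vectors, and the conclusion *)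

Lemma flip_averaging {R : realType} {d : nat}
    (a : {ffun 'I_d -> bool} -> 'I_d -> \bar R) (c : R) :
    (forall s i, 0 <= a s i)%E ->
    (forall s i, c%:E <= a s i + a (flip i s) i)%E ->
  exists s, ((d%:R * c / 2)%:E <= \sum_(i < d) a s i)%E.
Proof.
(* If every sign vector fell short, the total over all of them would be too small for the sums over
   flipped pairs. *)
move=> a0 ac; apply: contrapT => /forallNP noS.
have lt_s s : (\sum_(i < d) a s i < (d%:R * c / 2)%:E)%E.
  by rewrite ltNge; apply/negP/noS.
(* The assumed upper bounds make all values finite, so the double counting can take place in [R]. *)
have fin s i : a s i \is a fin_num.
  rewrite ge0_fin_numE//; apply: le_lt_trans (lt_trans (lt_s s) (ltry _)).
  by rewrite (bigD1 i)//= leeDl// sume_ge0.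
pose b s i := fine (a s i).
have lt_b s : \sum_(i < d) b s i < d%:R * c / 2.
  rewrite -lte_fin -sumEFin; under eq_bigr do rewrite fineK//.
  exact: lt_s.
have bc s i : c <= b s i + b (flip i s) i.
  by rewrite -lee_fin EFinD !fineK.
have lt_sum : \sum_s \sum_(i < d) b s i <
              \sum_(s : {ffun 'I_d -> bool}) (d%:R * c / 2).
  (* A sum of strict inequalities is strict once some sign vector exists, also for [d = 0]. *)
  by apply: ltr_sum => //; apply/hasP; exists [ffun=> true].
have : \sum_(i < d) \sum_(s : {ffun 'I_d -> bool}) c <=
       \sum_(i < d) \sum_s (b s i + b s i).
  apply: ler_sum => i _; rewrite big_split/=.
  (* Flipping coordinate [i] permutes the sign vectors, so one copy of the sum may be taken over the
     flipped ones. *)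
  rewrite [X in _ + X](reindex_inj (inv_inj (flipK i)))/= -big_split/=.
  by apply: ler_sum => s _; exact: bc.
rewrite exchange_big [leRHS]exchange_big/= leNgt => /negP; apply.
under eq_bigr do rewrite big_split/=.
rewrite big_split/= -mulr2n -mulr_natl.
rewrite (lt_le_trans
  (y := 2 * \sum_(s : {ffun 'I_d -> bool}) (d%:R * c / 2)))//.
  by rewrite ltr_pM2l.
rewrite mulr_sumr ler_sum// => s _.
by rewrite sumr_const card_ord -mulr_natl; lra.
Qed.

Theorem proposition4 (R : realType) (d T : nat) (pi : policy R d) (B : R)
    (B_gt0 : 0 < B) (B_leT : B <= T%:R)
    (budget : forall I : instance R d,
      {ae outcome_law pi I T,
        forall w, (num_queries pi I T w)%:R <= B}) :
  exists I : instance R d,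
    ((d%:R * T%:R / (80 * Num.sqrt B))%:E
       <= 'E_(outcome_law pi I T)[regret pi I T])%E.
Proof.
(* Then [d T D / 2] is the claimed bound, and [4 D^2 B = 4 / 1600] is below the required [1 / 2]. *)
pose D := (40 * Num.sqrt B)^-1.
have sB : 0 < Num.sqrt B by rewrite sqrtr_gt0.
have D0 : 0 <= D by rewrite invr_ge0 mulr_ge0.
have DB : 4 * D ^+ 2 * B <= 1 / 2.
  rewrite -[X in _ * X](sqr_sqrtr (ltW B_gt0)).
  rewrite (_ : _ * _ = 4 / 1600); first lra.
  by rewrite /D; field; rewrite gt_eqF.
have [||s s_large] := @flip_averaging R d
  (fun s i => \int[seed_law pi \x iid_law std_normal T]_w
                (coord_regret pi T D s i w)%:E)%E (T%:R * D).
- move=> s i; apply: integral_ge0 => w _; rewrite lee_fin.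
  by case/andP: (coord_regret_bounds pi T D D0 s i w).
- by move=> s i; exact: coord_regret_flip_sum D0 s i B (budget _) DB.
exists (sign_instance D s); rewrite expected_regret_coord//.
rewrite (_ : _ / _ = d%:R * (T%:R * D) / 2)//.
by rewrite /D; field; rewrite gt_eqF.
Qed.
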